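(* Let $A\in\mathbb{R}^{n\times n}$ be a symmetric matrix with eigenvalues $\lambda_1\le\dots\le\lambda_n$ and orthonormal eigenvectors $u_1,\dots,u_n$ ($A u_j=\lambda_j u_j$). Let $s\ge 1$ be an integer, let $x_1,\dots,x_s\in\mathbb{R}^n$ be independent random vectors with i.i.d. standard Gaussian $\mathcal{N}(0,1)$ entries, fix $k\in\{1,\dots,n\}$ with $\lambda_k$ distinct from the other eigenvalues, and let $y_s=\sum_{i=1}^s |u_k^T x_i|^2$. Given $\delta\in(0,1)$ and $\varepsilon\in(0,1)$, if the number of samples $s$ satisfies $$ s\ \ge\ \left\lceil \frac{2\log(1/\delta)}{\log(1/\varepsilon)+\varepsilon-1}\right\rceil, $$ then $$ \mathbb{P}(y_s\le s\varepsilon)\le\delta, $$ i.e., the jump at $\lambda_k$ is $\varepsilon$-small with probability at most $\delta$.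
   Context: $\log$ is the natural logarithm. For $\mu\in\mathbb{R}$ not an eigenvalue of $A$, let $P_\mu=\sum_{j:\lambda_j<\mu}u_ju_j^T$ be the spectral projector associated with the eigenvalues below $\mu$, and let $\mathrm{tr}^{\mathrm H}_s(P_\mu)=\frac1s\sum_{i=1}^s x_i^TP_\mu x_i$ be Hutchinson's trace estimator, with the same sample vectors $x_1,\dots,x_s$ used for all $\mu$. If $\lambda_{k-1}<\mu<\lambda_k<\mu'<\lambda_{k+1}$ (omitting inequalities with undefined indices), then $\mathrm{tr}^{\mathrm H}_s(P_{\mu'})-\mathrm{tr}^{\mathrm H}_s(P_\mu)=\frac1s\sum_{i=1}^s|u_k^Tx_i|^2=y_s/s$, which is called the height of the jump at $\lambda_k$. The jump at $\lambda_k$ is called $\varepsilon$-small if $y_s\le s\varepsilon$. *)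

(* Defs.v *)
From HB Require Import structures.
From mathcomp Require Export all_boot all_order all_algebra.
From mathcomp Require Export all_classical all_reals all_analysis.

Set Implicit Arguments.
Unset Strict Implicit.
Unset Printing Implicit Defensive.

Import Order.TTheory GRing.Theory Num.Theory.
Import numFieldNormedType.Exports.

Local Open Scope classical_set_scope.
Local Open Scope ring_scope.

(* The index type is finite, so the product rule over all subfamilies J is
   mutual independence.  The X i are intended to be measurable. *)
Definition mutually_independent d (T : measurableType d) (R : realType)
    (P : probability T R) (I : finType) d' (T' : measurableType d')
    (X : I -> T -> T') : Prop :=
  forall (J : {set I}) (B : I -> set T'), (forall i, measurable (B i)) ->
    P [set w | forall i, i \in J -> B i (X i w)] =
    (\prod_(i in J) P (X i @^-1` B i))%E.

(* The measure [P] is only meaningful on measurable sets, whence the guard. *)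
Definition std_gaussian d (T : measurableType d) (R : realType)
    (P : probability T R) (X : T -> R) : Prop :=
  forall B : set R, measurable B -> P (X @^-1` B) = normal_prob 0 1 B.

(* Vectors of R^n are taken as tuples when they are random, since [n.-tuple R]
   carries the product (i.e. Borel) sigma-algebra while ['cV[R]_n] has no
   measurable structure. *)
Definition colvec (R : realType) (n : nat) (v : n.-tuple R) : 'cV[R]_n :=
  \col_j tnth v j.

Definition iid_std_gaussian_entries d (T : measurableType d) (R : realType)
    (P : probability T R) (n : nat) (X : T -> n.-tuple R) : Prop :=
  mutually_independent P (fun (j : 'I_n) (w : T) => tnth (X w) j) /\
  (forall j : 'I_n, std_gaussian P (fun w : T => tnth (X w) j)).

Definition orthonormal_family (R : realType) (n : nat) (u : 'I_n -> 'cV[R]_n)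
    : Prop :=
  forall i j : 'I_n, ((u i)^T *m u j) 0 0 = (i == j)%:R.

(* [y_stat u x w / s] is the jump that Hutchinson's estimator of the trace of
   the spectral projectors, with sample vectors [x i w], makes at a simple
   eigenvalue with unit eigenvector [u]; the jump is eps-small when
   [y_stat u x w <= s%:R * eps]. *)
Definition y_stat d (T : measurableType d) (R : realType) (n s : nat)
    (u : 'cV[R]_n) (x : 'I_s -> T -> n.-tuple R) (w : T) : R :=
  \sum_(i < s) `|(u^T *m colvec (x i w)) 0 0| ^+ 2.

(* Main.v *)
From HB Require Import structures.
Require Import Defs.
From mathcomp Require Import all_boot all_order all_algebra.
From mathcomp Require Import all_classical all_reals all_analysis.
From mathcomp Require Import measurable_realfun ring lra.

(** The projections of the x_i on the unit vector u_k are independent standard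
    Gaussian variables, so y_s is chi-squared with s degrees of freedom, and the
    theorem is the Chernoff bound for its lower tail: for t > 0,

      P (y_s <= s eps) <= exp (t s eps) E exp (- t y_s)
                        = exp (t s eps) (1 + 2 t)^(-s/2).

    The optimal t satisfies 1 + 2 t = 1 / eps and turns the right-hand side into
    exp (- s (log (1 / eps) + eps - 1) / 2), which is at most delta exactly when
    s >= 2 log (1 / delta) / (log (1 / eps) + eps - 1)
    ([lower_tail_chernoff], [chernoff_exponent]).

    The Laplace transform of y_s is computed directly from the law of the
    entries, by adding one independent summand at a time.  A partial sum of a mutually independent family is independent of the next
    variable, by uniqueness of finite measures on a stable family of generators,
    hence that variable can be integrated out first
    ([expectation_partial_sum_next]).  Done for the s samples, this makes
    E exp (- t y_s) a product of s factors ([integral_expR_sum]).  Done for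
    the n coordinates of one sample, it evaluates one factor: a
    Gaussian integral over one coordinate sends exp (- t z^2) to another
    function of the same shape ([normal_mgf_sqr]), and the constants telescope
    to (1 + 2 t |u_k|^2)^(-1/2) ([gaussian_combination_mgf_sqr]). *)

Set Implicit Arguments.
Unset Strict Implicit.
Unset Printing Implicit Defensive.

Import Order.TTheory GRing.Theory Num.Theory.
Import numFieldNormedType.Exports.

Local Open Scope classical_set_scope.
Local Open Scope ring_scope.

(** * Sums of independent random variables *)

Lemma mutually_independent_comp (R : realType) d (T : measurableType d)
    (P : probability T R) (I : finType) d1 (T1 : measurableType d1)
    d2 (T2 : measurableType d2) (X : I -> T -> T1) (h : I -> T1 -> T2) :
  (forall i, measurable_fun setT (h i)) ->
  mutually_independent P X ->
  mutually_independent P (fun i w => h i (X i w)).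
Proof.
move=> mh XP J B mB.
rewrite (XP J (fun i => h i @^-1` B i))//.
by move=> i; rewrite -[X in measurable X]setTI; exact: mh.
Qed.

(** Rectangles are stable under intersection and generate the product
    sigma-algebra, so two finite measures that agree on them are equal: here the
    law of (X, Y) restricted to C, and the law of (X, Y) scaled by P C. *)
Lemma independent_pair_event (R : realType) d (T : measurableType d)
    (P : probability T R) d1 (T1 : measurableType d1)
    d2 (T2 : measurableType d2) (X : T -> T1) (Y : T -> T2) (C : set T) :
  measurable_fun setT X -> measurable_fun setT Y -> measurable C ->
  (forall A B, measurable A -> measurable B ->
    P (X @^-1` A `&` Y @^-1` B `&` C) =
    (P (X @^-1` A `&` Y @^-1` B) * P C)%E) ->
  forall D : set (T1 * T2), measurable D ->
    P ((fun w => (X w, Y w)) @^-1` D `&` C) =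
    (P ((fun w => (X w, Y w)) @^-1` D) * P C)%E.
Proof.
move=> mX mY mC XYC D mD.
have mXY : measurable_fun setT (fun w => (X w, Y w)).
  exact: measurable_fun_pair.
pose XY : {mfun T >-> (T1 * T2)%type} :=
  HB.pack (fun w => (X w, Y w)) (isMeasurableFun.Build _ _ _ _ _ mXY).
pose c : {nonneg R} := NngNum (fine_ge0 (measure_ge0 P C)).
have cE : (c%:num)%:E = P C by rewrite /= fineK ?fin_num_measure.
pose m1 := pushforward (mrestr P mC) XY.
pose m2 := mscale c (distribution P XY).
have m2E A : m2 A = (P (XY @^-1` A) * P C)%E by rewrite muleC -cE.
suff : m1 D = m2 D.
  by move=> m12; rewrite -(m2E D) -m12.
pose G := [set A `*` B | A in @measurable _ T1 & B in @measurable _ T2].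
apply: (measure_unique G (fun=> setT)) => //.
- exact: measurable_prod_measurableType.
- move=> _ _ [A1 mA1 [A2 mA2 <-]] [B1 mB1 [B2 mB2 <-]].
  rewrite -setXI; exists (A1 `&` B1); first exact: measurableI.
  by exists (A2 `&` B2) => //; exact: measurableI.
- by move=> _; exists setT => //; exists setT => //; rewrite setXTT.
- by rewrite bigcup_const.
- move=> _ [A mA [B mB <-]].
  by apply: etrans (XYC _ _ mA mB) _; exact/esym/(m2E (A `*` B)).
- move=> _; have : (P (setT `&` C) < +oo)%E.
    by rewrite setTI ltey_eq fin_num_measure.
  exact.
Qed.

(** The joint law of an independent pair is the product of the marginal laws, to
    which Tonelli's theorem applies. *)
Lemma expectation_independent_pair (R : realType) d (T : measurableType d)
    (P : probability T R) d1 (T1 : measurableType d1)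
    d2 (T2 : measurableType d2) (X : T -> T1) (Y : T -> T2)
    (F : T1 * T2 -> \bar R) :
  measurable_fun setT X -> measurable_fun setT Y ->
  (forall A B, measurable A -> measurable B ->
    P (X @^-1` A `&` Y @^-1` B) = (P (X @^-1` A) * P (Y @^-1` B))%E) ->
  measurable_fun setT F -> (forall z, 0 <= F z)%E ->
  (\int[P]_w F (X w, Y w) = \int[P]_w \int[P]_w' F (X w, Y w'))%E.
Proof.
move=> mX mY XYP mF F0.
pose X' : {mfun T >-> T1} := HB.pack X (isMeasurableFun.Build _ _ _ _ _ mX).
pose Y' : {mfun T >-> T2} := HB.pack Y (isMeasurableFun.Build _ _ _ _ _ mY).
have mXY : measurable_fun setT (fun w => (X w, Y w)).
  exact: measurable_fun_pair.
pose XY : {mfun T >-> (T1 * T2)%type} :=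
  HB.pack (fun w => (X w, Y w)) (isMeasurableFun.Build _ _ _ _ _ mXY).
transitivity (\int[distribution P XY]_z F z)%E.
  by rewrite (@ge0_integral_distribution _ _ _ _ _ P XY).
rewrite (eq_measure_integral (distribution P X' \x distribution P Y')%E);
  last first.
  move=> A mA _; apply/esym.
  by apply: product_measure_unique => //= B C mB mC; exact: XYP.
rewrite fubini_tonelli1// (@ge0_integral_distribution _ _ _ _ _ P X')//.
- apply: eq_integral => w _ /=; rewrite /fubini_F.
  rewrite (@ge0_integral_distribution _ _ _ _ _ P Y')//.
  by apply: (measurableT_comp mF); exact: measurable_fun_pair.
- exact: measurable_fun_fubini_tonelli_F.
- by move=> x; apply: integral_ge0.
Qed.

Lemma big_ord_ltS (V : Type) (idx : V) (op : Monoid.com_law idx) n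
    (F : 'I_n -> V) j (jn : (j < n)%N) :
  \big[op/idx]_(i < n | (i < j.+1)%N) F i =
  op (\big[op/idx]_(i < n | (i < j)%N) F i) (F (Ordinal jn)).
Proof.
rewrite (bigD1 (Ordinal jn))//= Monoid.mulmC; congr (op _ _).
by apply: eq_bigl => i; rewrite -val_eqE/= ltnS ltn_neqAle andbC.
Qed.

Lemma big_ord_lt_all (V : Type) (idx : V) (op : V -> V -> V) n
    (F : 'I_n -> V) :
  \big[op/idx]_(i < n | (i < n)%N) F i = \big[op/idx]_(i < n) F i.
Proof. by apply: eq_bigl => i; rewrite ltn_ord. Qed.

Section partial_sums.
Context (R : realType) d (T : measurableType d) (P : probability T R).
Context (n : nat) (g : 'I_n -> T -> R).
Hypothesis mg : forall i, measurable_fun setT (g i).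
Hypothesis gP : mutually_independent P g.

(** Indexed by all of nat, and constant from n on, so that an induction can
    start from the empty sum. *)
Definition partial_sum (j : nat) (w : T) : R := \sum_(i < n | (i < j)%N) g i w.

Lemma measurable_partial_sum j : measurable_fun setT (partial_sum j).
Proof.
have -> : partial_sum j = fun w => \sum_(i < n) if (i < j)%N then g i w else 0.
  by apply/funext => w; rewrite /partial_sum big_mkcond.
by apply: measurable_sum => i; case: (i < j)%N.
Qed.

Lemma partial_sum0 w : partial_sum 0 w = 0.
Proof. by rewrite /partial_sum big_pred0. Qed.

Lemma partial_sum_all w : partial_sum n w = \sum_(i < n) g i w.
Proof. exact: big_ord_lt_all. Qed.

Lemma partial_sumS j (jn : (j < n)%N) w :
  partial_sum j.+1 w = partial_sum j w + g (Ordinal jn) w.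
Proof. exact: big_ord_ltS. Qed.

Let tail_event (B : 'I_n -> set R) j :=
  [set w | forall i : 'I_n, (j <= i)%N -> B i (g i w)].

Let measurable_tail_event B j : (forall i, measurable (B i)) ->
  measurable (tail_event B j).
Proof.
move=> mB.
rewrite (_ : tail_event B j =
    \bigcap_(i in [set i : 'I_n | (j <= i)%N]) (g i @^-1` B i)) //.
apply: fin_bigcap_measurable; first exact: finite_finset.
by move=> i _; rewrite -[X in measurable X]setTI; exact: mg.
Qed.

Let tail_eventS B j (jn : (j < n)%N) :
  tail_event B j = g (Ordinal jn) @^-1` B (Ordinal jn) `&` tail_event B j.+1.
Proof.
apply/seteqP; split => w /= => [wB|[wj wB] i ji].
  by split; [exact: wB | move=> i ji; apply: wB; exact: ltnW].
have [ij|ij] := eqVneq i (Ordinal jn); first by rewrite ij.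
by apply: wB; rewrite ltn_neqAle ji eq_sym andbT.
Qed.

Let independent_tail_event B j (jn : (j < n)%N) :
  (forall i, measurable (B i)) ->
  P (tail_event B j) =
  (P (g (Ordinal jn) @^-1` B (Ordinal jn)) * P (tail_event B j.+1))%E.
Proof.
move=> mB.
have tail_eventE m : tail_event B m =
    [set w | forall i, i \in [set i : 'I_n | (m <= i)%N]%SET -> B i (g i w)].
  by apply/seteqP; split => w /= wB i; have := wB i; rewrite inE.
rewrite !tail_eventE !(gP _ mB) (bigD1 (Ordinal jn)) ?inE//=.
congr (_ * _)%E; apply: eq_bigl => i.
by rewrite !inE -val_eqE/= andbC eq_sym -ltn_neqAle.
Qed.

Let set_at (k : 'I_n) (A : set R) (B : 'I_n -> set R) i :=
  if i == k then A else B i.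

Let measurable_set_at k A B : measurable A -> (forall i, measurable (B i)) ->
  forall i, measurable (set_at k A B i).
Proof. by move=> mA mB i; rewrite /set_at; case: ifP. Qed.

Let tail_event_set_at j (jn : (j < n)%N) A B :
  tail_event (set_at (Ordinal jn) A B) j.+1 = tail_event B j.+1.
Proof.
by apply/seteqP; split => w /= wB i ji; have := wB i ji;
  rewrite /set_at -val_eqE/= gtn_eqF.
Qed.

Let tail_event_set_at_setT j (jn : (j < n)%N) A :
  tail_event (set_at (Ordinal jn) A (fun=> setT)) j = g (Ordinal jn) @^-1` A.
Proof.
rewrite (tail_eventS _ jn) tail_event_set_at {1}/set_at eqxx.
by rewrite (_ : tail_event _ _ = setT) ?setIT//; apply/seteqP.
Qed.

(** The invariant of the induction keeps all the later variables in play: that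
    the j-th partial sum is independent of the j-th variable alone would not
    propagate to j+1. *)
Let independent_partial_sum_tail B j A : (j <= n)%N ->
  (forall i, measurable (B i)) -> measurable A ->
  P (partial_sum j @^-1` A `&` tail_event B j) =
  (P (partial_sum j @^-1` A) * P (tail_event B j))%E.
Proof.
elim: j A B => [|j IHj] A B jn mB mA.
  have -> : partial_sum 0 @^-1` A = if 0 \in A then setT else set0.
    apply/seteqP; split => w /=; rewrite partial_sum0; first by move/mem_set ->.
    by case: ifPn => [/set_mem//|_ []].
  case: ifPn => _; first by rewrite setTI probability_setT mul1e.
  by rewrite set0I measure0 mul0e.
pose k := Ordinal jn.
have -> : partial_sum j.+1 @^-1` A =
    (fun w => (partial_sum j w, g k w)) @^-1` ((fun z => z.1 + z.2) @^-1` A).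
  by apply/seteqP; split => w /=; rewrite (partial_sumS jn).
apply: (independent_pair_event (measurable_partial_sum j) (mg k)
  (measurable_tail_event j.+1 mB)).
  move=> A1 A2 mA1 mA2.
  have pair : P (partial_sum j @^-1` A1 `&` g k @^-1` A2) =
      (P (partial_sum j @^-1` A1) * P (g k @^-1` A2))%E.
    have mU := measurable_set_at k mA2 (fun=> measurableT).
    have := IHj A1 _ (ltnW jn) mU mA1.
    by rewrite tail_event_set_at_setT.
  have mU := measurable_set_at k mA2 mB.
  have := IHj A1 _ (ltnW jn) mU mA1.
  rewrite (independent_tail_event jn mU) (tail_eventS _ jn) tail_event_set_at.
  by rewrite /set_at eqxx pair -setIA muleA.
rewrite -[X in measurable X]setTI.
by apply: (measurable_funD measurable_fst measurable_snd).
Qed.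

(** The j-th partial sum is a function of the variables before the j-th one, so
    the latter can be integrated out with the former held fixed. *)
Lemma expectation_partial_sum_next j (jn : (j < n)%N) (F : R * R -> \bar R) :
  measurable_fun setT F -> (forall z, 0 <= F z)%E ->
  (\int[P]_w F (partial_sum j w, g (Ordinal jn) w) =
   \int[P]_w \int[P]_w' F (partial_sum j w, g (Ordinal jn) w'))%E.
Proof.
apply: expectation_independent_pair; first exact: measurable_partial_sum.
  exact: mg.
move=> A B mA mB.
have mU := measurable_set_at (Ordinal jn) mB (fun=> measurableT).
have := independent_partial_sum_tail (ltnW jn) mU mA.
by rewrite tail_event_set_at_setT.
Qed.

End partial_sums.

Lemma integral_expR_sum (R : realType) d (T : measurableType d)
    (P : probability T R) n (g : 'I_n -> T -> R) :
  (forall i, measurable_fun setT (g i)) -> mutually_independent P g ->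
  (\int[P]_w (expR (\sum_(i < n) g i w))%:E =
   \prod_(i < n) \int[P]_w (expR (g i w))%:E)%E.
Proof.
move=> mg gP.
suff partial j : (j <= n)%N -> (\int[P]_w (expR (partial_sum g j w))%:E =
    \prod_(i < n | (i < j)%N) \int[P]_w (expR (g i w))%:E)%E.
  have := partial n (leqnn n); rewrite big_ord_lt_all => <-.
  by apply: eq_integral => w _; rewrite partial_sum_all.
elim: j => [_|j IHj jn].
  rewrite big_pred0// (eq_integral (cst 1%E)).
    by rewrite integral_cst// mul1e; exact: probability_setT.
  by move=> w _; rewrite partial_sum0 expR0.
rewrite (big_ord_ltS _ _ jn)/= -IHj ?(ltnW jn)//.
pose F (z : R * R) := ((expR z.1)%:E * (expR z.2)%:E)%E.
have mE (i : 'I_n) : measurable_fun setT (fun w => (expR (g i w))%:E).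
  by apply/measurable_EFinP; exact: measurableT_comp.
transitivity (\int[P]_w F (partial_sum g j w, g (Ordinal jn) w))%E.
  by apply: eq_integral => w _; rewrite partial_sumS expRD EFinM.
rewrite expectation_partial_sum_next//; last first.
- by move=> z; rewrite mule_ge0// lee_fin expR_ge0.
- by apply: emeasurable_funM; apply/measurable_EFinP; exact: measurableT_comp.
have E0 (i : 'I_n) : (0 <= \int[P]_w (expR (g i w))%:E)%E.
  by apply: integral_ge0 => w _; rewrite lee_fin expR_ge0.
have mS : measurable_fun setT (fun w => (expR (partial_sum g j w))%:E).
  apply/measurable_EFinP/measurableT_comp => //.
  exact: measurable_partial_sum.
rewrite -ge0_integralZr//.
by apply: eq_integral => w _; rewrite /F/= ge0_integralZl.
Qed.

(** * Laplace transform of the square of a Gaussian combination *)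

(** The density is almost everywhere the Radon-Nikodym derivative. *)
Lemma integral_normal_prob (R : realType) (m s : R) (f : R -> \bar R) :
  (normal_prob m s).-integrable setT f ->
  (\int[normal_prob m s]_x f x =
   \int[lebesgue_measure]_x (f x * (normal_pdf m s x)%:E))%E.
Proof.
move=> intf.
have Nmu := normal_prob_dominates m s.
have mf : measurable_fun setT f by exact: measurable_int intf.
have mpdf : measurable_fun setT (fun x => (normal_pdf m s x)%:E).
  by apply/measurable_EFinP; exact: measurable_normal_pdf.
rewrite -(Radon_Nikodym_change_of_variables Nmu)//.
apply: ae_eq_integral => //.
- exact: emeasurable_funM.
- exact: emeasurable_funM.
- apply: ae_eqe_mul2l; apply: integral_ae_eq => //.
    by apply: Radon_Nikodym_integrable; exact: Nmu.
  by move=> E _ mE; rewrite -Radon_Nikodym_integral//; exact: Nmu.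
Qed.

(** Completing the square: with D = 1 + 2 t a^2,
    - t (x + a y)^2 - y^2 / 2 = - (t / D) x^2 - D (y - m)^2 / 2
    where m = - 2 t a x / D.  The last term is the exponent of the normal
    density of mean m and variance 1 / D, whose peak exceeds that of the
    standard one by the factor D^(1/2).  Since the result is again a Gaussian
    function of x, the computation can be iterated over several coordinates. *)
Lemma normal_mgf_sqr (R : realType) (t a x : R) : 0 <= t ->
  (\int[normal_prob 0 1]_y (expR (- t * (x + a * y) ^+ 2))%:E =
   ((Num.sqrt (1 + 2 * t * a ^+ 2))^-1 *
    expR (- (t / (1 + 2 * t * a ^+ 2)) * x ^+ 2))%:E)%E.
Proof.
move=> t0.
set D := 1 + 2 * t * a ^+ 2.
have D0 : 0 < D.
  by rewrite ltr_pwDl// mulr_ge0 ?sqr_ge0// mulr_ge0.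
have mf : measurable_fun setT (fun y : R => expR (- t * (x + a * y) ^+ 2)).
  apply: measurableT_comp => //; apply: measurable_funM => //.
  apply: measurable_funX; apply: measurable_funD => //.
have intf : (normal_prob 0 1).-integrable setT
    (fun y : R => (expR (- t * (x + a * y) ^+ 2))%:E).
  apply: (@le_integrable _ _ _ _ _ _ _ (cst 1)%E) => //.
  - exact/measurable_EFinP.
  - move=> y _ /=; rewrite lee_fin !ger0_norm ?expR_ge0//.
    by rewrite -[leRHS]expR0 ler_expR mulNr oppr_le0 mulr_ge0 ?sqr_ge0.
  - by apply: finite_measure_integrable_cst.
rewrite integral_normal_prob//.
pose v := (Num.sqrt D)^-1.
have v0 : v != 0 by rewrite invr_eq0 gt_eqF// sqrtr_gt0.
have v2 : v ^+ 2 = D^-1 by rewrite exprVn sqr_sqrtr// ltW.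
pose m := - (2 * t * a * x / D).
transitivity (\int[lebesgue_measure]_y
    ((v * expR (- (t / D) * x ^+ 2))%:E * (normal_pdf m v y)%:E))%E.
  apply: eq_integral => y _; rewrite -!EFinM; congr EFin.
  rewrite !normal_pdfE ?oner_eq0//= /normal_fun/normal_peak v2.
  rewrite (_ : (Num.sqrt (D^-1 * pi *+ 2))^-1 =
    v^-1 * (Num.sqrt (1 ^+ 2 * pi *+ 2))^-1); last first.
    rewrite expr1n mul1r -mulrnAr sqrtrM ?invr_ge0 ?ltW//.
    by rewrite invfM sqrtrV ?ltW.
  rewrite mulrCA -expRD mulrACA mulVKf// -expRD; congr (_ * expR _).
  rewrite /m /D; have := lt0r_neq0 D0; rewrite /D => Dn0.
  by field.
rewrite ge0_integralZl//.
- by rewrite integral_normal_pdf mule1.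
- by apply/measurable_EFinP; exact: measurable_normal_pdf.
- by move=> y _; rewrite lee_fin normal_pdf_ge0.
- by rewrite lee_fin mulr_ge0 ?expR_ge0// invr_ge0.
Qed.

Lemma integral_std_gaussian (R : realType) d (T : measurableType d)
    (P : probability T R) (X : T -> R) (f : R -> \bar R) :
  measurable_fun setT X -> std_gaussian P X ->
  measurable_fun setT f -> (forall y, 0 <= f y)%E ->
  (\int[P]_w f (X w) = \int[normal_prob 0 1]_y f y)%E.
Proof.
move=> mX gX mf f0.
(* Integrals against normal_prob live on another name for the Borel space of R,
   so the image measure of X is formed there too. *)
have mX' : measurable_fun setT (X : T -> measurableTypeR R) by exact: mX.
have mf' : measurable_fun setT (f : measurableTypeR R -> _) by exact: mf.
transitivity (\int[pushforward P (X : T -> measurableTypeR R)]_y f y)%E.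
  by rewrite (ge0_integral_pushforward mX').
by apply: eq_measure_integral => A mA _; exact: gX.
Qed.

(** Integrating out the last summand replaces t by t / D and produces a factor
    D^(-1/2), where D = 1 + 2 t a_j^2.  If v is the sum of the squares of the
    earlier coefficients then D (1 + 2 (t / D) v) = 1 + 2 t (a_j^2 + v), so the
    factors telescope.  As t changes at each step, the induction is on a
    statement about all t. *)
Lemma gaussian_combination_mgf_sqr (R : realType) d (T : measurableType d)
    (P : probability T R) n (g : 'I_n -> T -> R) (a : 'I_n -> R) (t : R) :
  (forall i, measurable_fun setT (g i)) -> mutually_independent P g ->
  (forall i, std_gaussian P (g i)) -> 0 <= t ->
  (\int[P]_w (expR (- t * (\sum_(i < n) a i * g i w) ^+ 2))%:E =
   ((Num.sqrt (1 + 2 * t * \sum_(i < n) a i ^+ 2))^-1)%:E)%E.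
Proof.
move=> mg gP gN t0.
pose ag (i : 'I_n) w := a i * g i w.
have mag i : measurable_fun setT (ag i) by exact: measurable_funM.
have agP : mutually_independent P ag.
  apply: (mutually_independent_comp (h := fun i y => a i * y)) gP => i.
  exact: measurable_funM.
pose sa j := \sum_(i < n | (i < j)%N) a i ^+ 2.
have sa0 j : 0 <= sa j by apply: sumr_ge0 => i _; rewrite sqr_ge0.
suff partial j : (j <= n)%N -> forall t, 0 <= t ->
    (\int[P]_w (expR (- t * partial_sum ag j w ^+ 2))%:E =
     ((Num.sqrt (1 + 2 * t * sa j))^-1)%:E)%E.
  have := partial n (leqnn n) t t0; rewrite /sa big_ord_lt_all => <-.
  by apply: eq_integral => w _; rewrite partial_sum_all.
elim: j {t t0} => [_|j IHj jn] t t0.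
  rewrite /sa big_pred0// mulr0 addr0 sqrtr1 invr1 (eq_integral (cst 1%E)).
    by rewrite integral_cst// mul1e; exact: probability_setT.
  by move=> w _; rewrite partial_sum0 expr0n/= mulr0 expR0.
pose k := Ordinal jn.
pose D := 1 + 2 * t * a k ^+ 2.
have D0 : 0 < D by rewrite ltr_pwDl// mulr_ge0 ?sqr_ge0// mulr_ge0.
pose F (z : R * R) := (expR (- t * (z.1 + z.2) ^+ 2))%:E.
have mexp (h : R * R -> R) : measurable_fun setT h ->
    measurable_fun setT (fun z => (expR (- t * h z ^+ 2))%:E).
  move=> mh; apply/measurable_EFinP/measurableT_comp => //.
  by apply: measurable_funM => //; exact: measurable_funX.
transitivity (\int[P]_w F (partial_sum ag j w, ag k w))%E.
  by apply: eq_integral => w _; rewrite (partial_sumS _ jn).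
have mF : measurable_fun setT F by apply: mexp; exact: measurable_funD.
have F0 z : (0 <= F z)%E by rewrite lee_fin expR_ge0.
rewrite expectation_partial_sum_next//.
transitivity (\int[P]_w ((Num.sqrt D)^-1%:E *
    (expR (- (t / D) * partial_sum ag j w ^+ 2))%:E))%E.
  apply: eq_integral => w _; rewrite -EFinM -normal_mgf_sqr// /F/=.
  pose f y := (expR (- t * (partial_sum ag j w + a k * y) ^+ 2))%:E.
  have f0 y : (0 <= f y)%E by rewrite lee_fin expR_ge0.
  rewrite (integral_std_gaussian (f := f))//.
  apply/measurable_EFinP/measurableT_comp => //.
  apply: measurable_funM => //; apply: measurable_funX.
  by apply: measurable_funD => //; exact: measurable_funM.
have mS : measurable_fun setT (fun w =>
    (expR (- (t / D) * partial_sum ag j w ^+ 2))%:E).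
  apply/measurable_EFinP/measurableT_comp => //; apply: measurable_funM => //.
  by apply: measurable_funX; exact: measurable_partial_sum.
rewrite ge0_integralZl//.
rewrite IHj ?(ltnW jn)//; last by rewrite divr_ge0// ltW.
rewrite -EFinM -invfM -sqrtrM ?ltW//; congr (_^-1%:E); congr (Num.sqrt _).
rewrite /sa (big_ord_ltS _ _ jn)/= -/k -/(sa j) mulrDr mulr1.
have -> : D * (2 * (t / D) * sa j) = 2 * t * sa j.
  by move: (lt0r_neq0 D0) => Dn0; field.
by rewrite /D; ring.
Qed.

(** * The lower tail of y_s *)

(** The upper-tail Chernoff bound, applied to - Y. *)
Lemma lower_tail_chernoff (R : realType) d (T : measurableType d)
    (P : probability T R) (Y : T -> R) (t b : R) :
  measurable_fun setT Y -> 0 < t ->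
  (P [set w | Y w <= b]%R <=
   \int[P]_w (expR (- t * Y w))%:E * (expR (t * b))%:E)%E.
Proof.
move=> mY t0.
have mN : measurable_fun setT (fun w => - Y w) by exact: measurable_funN.
pose N : {mfun T >-> R} :=
  HB.pack (fun w => - Y w) (isMeasurableFun.Build _ _ _ _ _ mN).
have := @chernoff _ _ _ P N t (- b) t0.
rewrite /mmt_gen_fun unlock mulrN opprK.
rewrite (_ : [set w | - b <= N w] = [set w | Y w <= b]); last first.
  by apply/seteqP; split => w /=; rewrite lerN2.
congr (_ <= _ * _)%E; apply: eq_integral => w _ /=.
by rewrite mulrC mulrN mulNr.
Qed.

Lemma measurable_dot (R : realType) n (u : 'cV[R]_n) :
  measurable_fun setT (fun v : n.-tuple R => (u^T *m colvec v) 0 0).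
Proof.
rewrite (_ : (fun _ => _) = fun v => \sum_j u j 0 * tnth v j).
  apply: measurable_sum => j; apply: measurable_funM => //.
  exact: measurable_tnth.
by apply/funext => v; rewrite !mxE; apply: eq_bigr => j _; rewrite !mxE.
Qed.

Section y_stat.
Context (R : realType) d (T : measurableType d) (P : probability T R).
Context (n s : nat) (x : 'I_s -> {RV P >-> n.-tuple R}) (u : 'cV[R]_n).
Hypothesis x_indep : mutually_independent P x.
Hypothesis x_entries : forall i, iid_std_gaussian_entries P (x i).
Hypothesis u_unit : (u^T *m u) 0 0 = 1.

Lemma measurable_y_stat : measurable_fun setT (y_stat u x).
Proof.
apply: measurable_sum => i; apply: measurable_funX.
apply: measurableT_comp => //.
exact: (measurableT_comp (measurable_dot u)).
Qed.

(** For a unit vector u, the projection of a standard Gaussian vector on u is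
    again standard Gaussian; this is the trace of that fact on the Laplace
    transform of its square. *)
Lemma dot_mgf_sqr (i : 'I_s) (t : R) : 0 <= t ->
  (\int[P]_w (expR (- t * `|(u^T *m colvec (x i w)) 0 0| ^+ 2))%:E =
   ((Num.sqrt (1 + 2 * t))^-1)%:E)%E.
Proof.
move=> t0; have [xP xN] := x_entries i.
have mx j : measurable_fun setT (fun w => tnth (x i w) j).
  exact: (measurableT_comp (measurable_tnth j)).
have := gaussian_combination_mgf_sqr (fun j => u j 0) mx xP xN t0.
have -> : \sum_(j < n) u j 0 ^+ 2 = 1.
  rewrite -u_unit mxE; apply: eq_bigr => j _.
  by rewrite mxE expr2.
rewrite mulr1 => <-; apply: eq_integral => w _.
rewrite real_normK ?num_real//; congr (expR (_ * _ ^+ 2))%:E.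
by rewrite mxE; apply: eq_bigr => j _; rewrite !mxE.
Qed.

(** The Laplace transform of a chi-squared law with s degrees of freedom. *)
Lemma y_stat_mgf (t : R) : 0 <= t ->
  (\int[P]_w (expR (- t * y_stat u x w))%:E =
   ((Num.sqrt (1 + 2 * t))^-1 ^+ s)%:E)%E.
Proof.
move=> t0.
pose h (i : 'I_s) (v : n.-tuple R) := - t * `|(u^T *m colvec v) 0 0| ^+ 2.
have mh i : measurable_fun setT (h i).
  apply: measurable_funM => //; apply: measurable_funX.
  by apply: measurableT_comp => //; exact: measurable_dot.
have mhx i : measurable_fun setT (fun w => h i (x i w)).
  exact: (measurableT_comp (mh i)).
have := integral_expR_sum mhx (mutually_independent_comp mh x_indep).
under [in RHS]eq_bigr do rewrite dot_mgf_sqr//.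
rewrite prodEFin prodr_const card_ord => <-.
by apply: eq_integral => w _; rewrite /y_stat mulr_sumr.
Qed.

End y_stat.

(** Strictness makes the denominator of the bound on s positive. *)
Lemma ln_lt_subr1 (R : realType) (e : R) : 0 < e < 1 -> ln e < e - 1.
Proof.
move=> /andP[e0 e1].
have := @expR_gt1Dx R (ln e); rewrite lnK ?posrE// ltrBrDl; apply.
by rewrite ln_eq0// lt_eqF.
Qed.

(** For t = (1 / eps - 1) / 2 one has 1 + 2 t = 1 / eps and
    t eps = (1 - eps) / 2, so the left-hand side is exp (- s (ln (1 / eps) + eps - 1) / 2). *)
Lemma chernoff_exponent (R : realType) (s : nat) (delta eps : R) :
  0 < delta -> 0 < eps < 1 ->
  2 * ln (1 / delta) / (ln (1 / eps) + eps - 1) <= s%:R ->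
  (Num.sqrt (1 + 2 * ((eps^-1 - 1) / 2)))^-1 ^+ s *
    expR ((eps^-1 - 1) / 2 * (s%:R * eps)) <= delta.
Proof.
move=> d0 e01; have [e0 e1] := andP e01.
have en0 : eps != 0 by rewrite gt_eqF.
rewrite !div1r !lnV ?posrE//.
have c0 : 0 < - ln eps + eps - 1 by have := ln_lt_subr1 e01; lra.
rewrite ler_pdivrMr// => sc.
have -> : 1 + 2 * ((eps^-1 - 1) / 2) = eps^-1 by field.
have -> : (Num.sqrt eps^-1)^-1 = expR (ln eps / 2).
  rewrite -sqrtrV ?invr_ge0 ?ltW// invrK -[in LHS](@lnK _ eps) ?posrE//.
  rewrite [in LHS](_ : ln eps = ln eps / 2 + ln eps / 2); last by field.
  by rewrite expRD -expr2 sqrtr_sqr ger0_norm ?expR_ge0.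
rewrite -expRM_natl -expRD -[leRHS]lnK ?posrE// ler_expR.
have -> : (eps^-1 - 1) / 2 * (s%:R * eps) = s%:R * (1 - eps) / 2 by field.
lra.
Qed.

Unset Implicit Arguments.

Theorem lemma3p2 (R : realType) (d : measure_display) (T : measurableType d)
    (P : probability T R) (n : nat) (A : 'M[R]_n) (symA : A^T = A)
    (lambda : 'I_n -> R) (u : 'I_n -> 'cV[R]_n)
    (lambda_sorted : forall i j : 'I_n, (i <= j)%N -> lambda i <= lambda j)
    (u_orthonormal : orthonormal_family u)
    (u_eigen : forall j : 'I_n, A *m u j = lambda j *: u j)
    (s : nat) (s_ge1 : (1 <= s)%N)
    (x : 'I_s -> {RV P >-> n.-tuple R})
    (x_indep : mutually_independent P x)
    (x_entries : forall i : 'I_s, iid_std_gaussian_entries P (x i))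
    (k : 'I_n) (k_simple : forall j : 'I_n, j != k -> lambda j != lambda k)
    (delta eps : R) (delta01 : 0 < delta < 1) (eps01 : 0 < eps < 1)
    (s_large :
      Num.ceil (2 * ln (1 / delta) / (ln (1 / eps) + eps - 1)) <= s%:Z) :
  (P [set w | (y_stat (u k) x w <= s%:R * eps)%R] <= delta%:E)%E.
Proof.
have [eps0 eps1] := andP eps01; have [delta0 _] := andP delta01.
have u_unit : ((u k)^T *m u k) 0 0 = 1 by rewrite u_orthonormal eqxx.
(* The minimizer over t of the Chernoff bound (1 + 2 t)^(-s/2) exp (t s eps). *)
pose t := (eps^-1 - 1) / 2.
have t0 : 0 < t by rewrite divr_gt0// subr_gt0 invf_gt1.
apply: le_trans
  (lower_tail_chernoff P (s%:R * eps) (measurable_y_stat x (u k)) t0) _.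
rewrite (y_stat_mgf x_indep x_entries u_unit (ltW t0)) -EFinM lee_fin.
apply: chernoff_exponent => //.
apply: le_trans (ceil_ge _) _.
by rewrite -(ler_int R) in s_large.
Qed.
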